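(* Let $k\ge 2$ be an integer and let $T$ be a tree of order $n\ge 8$ and diameter $n-t$, where $2\le t\le n-3$. (i) If $2\le t\le \frac{n-1}{3}$, then $n-2t\le \alpha_{k-reg}(T)\le n-4$. (ii) If $\frac{n}{3}\le t\le n-5$, then $\frac{n+2}{3}\le \alpha_{k-reg}(T)\le \max\{n-f(n,t)-1,\ t+1\}$. (iii) If $t=n-4$, then $\lceil \frac{n-1}{2}\rceil\le \alpha_{k-reg}(T)\le t+1$. (iv) If $t=n-3$, then $\alpha_{k-reg}(T)=t+1$.
   Context: All graphs are finite, simple and undirected. For a graph $G$ and an integer $i\ge 0$, $D_i(G)$ denotes the set of vertices of degree $i$ in $G$. For an integer $k\ge 0$, a set $S\subseteq V(G)$ is $k$-independent if the induced subgraph $G[S]$ has maximum degree at most $k$. A regular $k$-independent set is a $k$-independent set $S$ with $S\subseteq D_i(G)$ for some $i$. The regular $k$-independence number $\alpha_{k-reg}(G)$ is the maximum cardinality of a regular $k$-independent set of $G$. For integers $n>t\ge 2$ with $t\le n-3$, define $f(n,t)=\lceil \frac{2(t-1)}{n-t}\rceil+2$ if $n-t$ is even, and $f(n,t)=\lceil\frac{2(t-1)}{n-t-1}\rceil+2$ if $n-t$ is odd. *)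

(* Defs.v *)
From mathcomp Require Import all_boot.

Set Implicit Arguments.
Unset Strict Implicit.
Unset Printing Implicit Defensive.

Section Graph.

Variables (V : finType) (e : rel V).

Definition simple_graph : Prop := symmetric e /\ irreflexive e.

Definition connected_graph : Prop := forall x y : V, connect e x y.

(* Since e is symmetric, [:: x; y] is a ucycle for every edge xy; the cycles
   of the graph are the ucycles with at least 3 vertices. *)
Definition acyclic_graph : Prop :=
  forall c : seq V, ucycle e c -> size c < 3.

Definition tree : Prop :=
  [/\ simple_graph, 0 < #|V|, connected_graph & acyclic_graph].

Definition deg (x : V) : nat := #|[set y | e x y]|.

(* D_i(G) *)
Definition degree_class (i : nat) : {set V} := [set x | deg x == i].

Definition walk_of_length (x y : V) (d : nat) : bool :=
  [exists p : d.-tuple V, path e x p && (last x p == y)].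

(* The least d with a walk of length d from x to y; by find's default, #|V|
   if x and y are not connected. *)
Definition dist (x y : V) : nat := find (walk_of_length x y) (iota 0 #|V|).

Definition diameter : nat := \max_(x : V) \max_(y : V) dist x y.

Definition induced_max_degree (S : {set V}) : nat :=
  \max_(x in S) #|[set y in S | e x y]|.

Definition k_independent (k : nat) (S : {set V}) : bool :=
  induced_max_degree S <= k.

(* i may be taken below #|V|, as all degrees of a simple graph are. *)
Definition regular_k_independent (k : nat) (S : {set V}) : bool :=
  k_independent k S && [exists i : 'I_#|V|, S \subset degree_class i].

Definition alpha_reg (k : nat) : nat :=
  \max_(S : {set V} | regular_k_independent k S) #|S|.

End Graph.

(* The ceiling of m / d, for d > 0. *)
Definition ceil_divn (m d : nat) : nat := m %/ d + ~~ (d %| m).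

Definition f (n t : nat) : nat :=
  if odd (n - t) then ceil_divn (2 * (t - 1)) (n - t - 1) + 2
  else ceil_divn (2 * (t - 1)) (n - t) + 2.

(* Main.v *)
Require Import Defs.
From mathcomp Require Import all_boot zify.

(** Write n_1, n_2 and n_3 for the numbers of vertices of degree 1, 2 and at
    least 3. The degree sum 2n - 2 of a tree gives n_3 + 2 <= n_1, so no degree
    class above 2 is larger than n_1; as the classes of degree 1 and 2 are
    2-independent, the regular k-independence number is max(n_1, n_2).

    Let d = n - t be the diameter, attained between x and y. The d - 1 inner
    vertices of the path from x to y are not leaves, whence n_1 <= t + 1. Each of
    the t - 1 vertices v off the path has a leaf w below it, and v is determined
    by w and dist v w. Since dist x v + dist y v is at least d + 2 (it exceeds d
    and has the parity of d) while dist x w and dist y w are at most d, one gets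
    2 (dist v w + 1) <= d. Hence t - 1 <= (n_1 - 2) * floor(d / 2), and the four
    claims are arithmetic consequences of these bounds. *)

Set Implicit Arguments.
Unset Strict Implicit.
Unset Printing Implicit Defensive.

(** Inside its own degree class a vertex has at most [i] neighbours, so the whole class is
    [k]-independent. *)
Lemma card_degree_class_le_alpha_reg (V : finType) (e : rel V) k i :
  i <= k -> i < #|V| -> #|degree_class e i| <= alpha_reg e k.
Proof.
move=> ik iV; apply: (@leq_bigmax_cond _ _ (fun S : {set V} => #|S|)).
apply/andP; split; last by apply/existsP; exists (Ordinal iV).
apply/bigmax_leqP => x; rewrite inE => /eqP dx; apply: leq_trans ik; rewrite -dx.
by apply/subset_leq_card/subsetP => y; rewrite !inE => /andP[].
Qed.

(** * Walks and distance *)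

Section Dist.

Variables (V : finType) (e : rel V).

Lemma walkP (x y : V) (d : nat) :
  reflect (exists p, [/\ path e x p, last x p = y & size p = d])
          (walk_of_length e x y d).
Proof.
apply: (iffP existsP) => [[p /andP[ep /eqP lp]]|[p [ep lp sp]]].
  by exists p; rewrite size_tuple.
have sp' : size p == d by apply/eqP.
by exists (Tuple sp'); rewrite /= ep lp eqxx.
Qed.

Lemma dist_le_walk x p : path e x p -> dist e x (last x p) <= size p.
Proof.
(* A walk with at least [#|V|] steps is covered by the default value of [find], which caps [dist] at
   [#|V|]. *)
move=> ep; have [lt|ge] := ltnP (size p) #|V|; last first.
  by apply: leq_trans ge; rewrite -[X in _ <= X](size_iota 0 #|V|) find_size.
rewrite leqNgt; apply/negP => /(before_find 0).
rewrite nth_iota // add0n; suff -> : walk_of_length e x (last x p) (size p) by [].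
by apply/walkP; exists p.
Qed.

Lemma dist_eq0 x y : dist e x y = 0 -> x = y.
Proof.
rewrite /dist => h; have V0 : 0 < #|V| by apply/card_gt0P; exists x.
have : has (walk_of_length e x y) (iota 0 #|V|) by rewrite has_find h size_iota.
move/(nth_find 0); rewrite h nth_iota // => /walkP[p [_ <- /size0nil ->]].
by [].
Qed.

Lemma dist_refl x : dist e x x = 0.
Proof. by have := dist_le_walk (x := x) (p := [::]) isT; rewrite leqn0 => /eqP. Qed.

Hypothesis conn : connected_graph e.

(** A connecting walk shortens to one without repeated vertices, whose length is below [#|V|]; hence
    [find] succeeds. *)
Lemma dist_walk x y :
  exists p, [/\ path e x p, last x p = y & size p = dist e x y].
Proof.
apply/walkP.
have hs : has (walk_of_length e x y) (iota 0 #|V|).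
  have /connectP[q eq ->] := conn x y.
  case: (shortenP eq) => p ep up _; apply/hasP; exists (size p).
    by rewrite mem_iota /= add0n -[(size p).+1]/(size (x :: p)) -(card_uniqP up) max_card.
  by apply/walkP; exists p.
have := nth_find 0 hs; rewrite nth_iota ?add0n //.
by move: hs; rewrite has_find size_iota.
Qed.

Lemma dist_triangle y x z : dist e x z <= dist e x y + dist e y z.
Proof.
have [p [ep lp <-]] := dist_walk x y; have [q [eq lq <-]] := dist_walk y z.
rewrite -size_cat -lq -lp -last_cat; apply: dist_le_walk.
by rewrite cat_path ep lp.
Qed.

Lemma dist_edge x y : e x y -> dist e x y <= 1.
Proof. by move=> xy; apply: (dist_le_walk (p := [:: y])); rewrite /= xy. Qed.

Hypothesis e_sym : symmetric e.

Lemma dist_sym x y : dist e x y = dist e y x.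
Proof.
suff le a b : dist e a b <= dist e b a by apply/eqP; rewrite eqn_leq !le.
have [p [ep lp <-]] := dist_walk b a.
have := @dist_le_walk a (rev (belast b p)).
rewrite -lp rev_path (eq_path (e' := e)) => [/(_ ep)|u v]; last exact: e_sym.
rewrite size_rev size_belast; suff -> : last (last b p) (rev (belast b p)) = b by [].
by case: (p) => //= c q; rewrite rev_cons last_rcons.
Qed.

Lemma dist_adj_le r x y : e x y -> dist e r y <= (dist e r x).+1.
Proof. by move=> /dist_edge xy; have := dist_triangle x r y; lia. Qed.

Lemma closer_neighbour r x :
  0 < dist e r x -> exists2 y, e x y & (dist e r y).+1 = dist e r x.
Proof.
rewrite dist_sym; have [[|y p] [/= ]] := dist_walk x r; first by move=> _ _ <-.
move=> /andP[xy yp] lp sp _; exists y => //.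
have := dist_le_walk yp; rewrite lp (dist_sym y r).
have := dist_adj_le r (x := y) (y := x); rewrite e_sym (dist_sym r x) => /(_ xy).
by rewrite -sp; lia.
Qed.

Lemma dist_le_diameter x y : dist e x y <= diameter e.
Proof. exact: leq_trans (leq_bigmax y) (leq_bigmax x). Qed.

Lemma diameter_attained : 0 < #|V| -> exists x y, dist e x y = diameter e.
Proof.
move=> V0; rewrite /diameter.
have [x ->] := eq_bigmax (fun x => \max_(y : V) dist e x y) V0.
by have [y ->] := eq_bigmax (dist e x) V0; exists x, y.
Qed.

End Dist.

(** * Distances from a root in a tree, and the degree sum *)

Section Tree.

Variables (V : finType) (e : rel V).
Hypothesis treeT : tree e.

Let e_sym : symmetric e. Proof. by case: treeT => -[]. Qed.
Let eirr : irreflexive e. Proof. by case: treeT => -[]. Qed.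
Let conn : connected_graph e. Proof. by case: treeT. Qed.

Local Notation D := (dist e).

(** Both ends descend to [r] through closer neighbours without leaving the ball. Such a path, closed
    up through vertices outside the ball, yields a forbidden cycle. *)
Lemma ball_path r m x y : D r x <= m -> D r y <= m ->
  exists p, [/\ path e x p, last x p = y, uniq (x :: p)
              & all (fun z => D r z <= m) (x :: p)].
Proof.
pose e' := [rel a b | [&& e a b, D r a <= m & D r b <= m]].
have sym' : connect_sym e'.
  by apply: sym_connect_sym => a b /=; rewrite e_sym; case: (e b a) => //=; rewrite andbC.
have to_r z : D r z <= m -> connect e' r z.
  move: {2}(D r z) (leqnn (D r z)) => l.
  elim: l z => [|l IH] z zl zm.
    by rewrite (dist_eq0 (x := r) (y := z) (e := e)) //; lia.
  have [z0|z0] := posnP (D r z); first by apply: IH; rewrite ?z0.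
  have [w zw wz] := closer_neighbour conn e_sym z0.
  apply: connect_trans (IH w _ _) (connect1 _); try lia.
  by rewrite /= e_sym zw zm andbT; lia.
move=> xm ym; have : connect e' x y.
  by apply: connect_trans (to_r y ym); rewrite sym' to_r.
case/connectP => q eq ->; case: (shortenP eq) => p ep up _.
exists p; split => //; first by apply: sub_path ep => a b /and3P[].
rewrite /= xm /=; elim: (p) (x) ep => //= b s IH a /andP[/and3P[_ _ ->] bs] /=.
exact: IH bs.
Qed.

Lemma no_cycle c : ucycle e c -> size c < 3.
Proof. by case: treeT => _ _ _; apply. Qed.

(** Otherwise a path from [y] to [z] in the ball of radius [D r x - 1] would close up through
    [x]. *)
Lemma closer_unique r x y z : e x y -> e x z ->
  D r y < D r x -> D r z < D r x -> y = z.
Proof.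
move=> xy xz yx zx; have [//|yz] := eqVneq y z.
have [||p [ep lp up ap]] := @ball_path r (D r x).-1 y z; try lia.
have : ucycle e (x :: y :: p).
  rewrite /ucycle /cycle /= xy rcons_path ep lp e_sym xz /=.
  move: up => /= ->; rewrite andbT; apply/negP => xp.
  by move/allP: ap => /(_ x xp); lia.
case: p lp {ep up ap} => [lp|a p _ /no_cycle //].
by rewrite -lp /= eqxx in yz.
Qed.

(** At equal distances, closer neighbours [u] of [x] and [w] of [y] are joined inside a smaller
    ball, and the edge [x y] closes a cycle. It has at least three vertices even if [u = w]. *)
Lemma dist_adj_neq r x y : e x y -> D r x <> D r y.
Proof.
move=> xy Dxy; have [x0|x0] := posnP (D r x).
  move: (x0) xy; rewrite Dxy => /dist_eq0 <-.
  by rewrite -(dist_eq0 x0) eirr.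
have [u xu ux] := closer_neighbour conn e_sym x0.
rewrite Dxy in x0; have [w yw wy] := closer_neighbour conn e_sym x0.
have [||p [ep lp up ap]] := @ball_path r (D r x).-1 u w; try lia.
have : ucycle e (y :: x :: u :: p).
  rewrite /ucycle /cycle /= e_sym xy xu rcons_path ep lp e_sym yw /=.
  move: up => /= ->; rewrite andbT !inE !negb_or.
  have -> /= : y != x by apply: contraTneq xy => ->; rewrite eirr.
  have far z : D r z = D r x -> z \notin u :: p.
    by move=> zx; apply/negP => /(allP ap); lia.
  by have := far y (esym Dxy); have := far x erefl; rewrite !inE !negb_or => -> ->.
by move/no_cycle.
Qed.

Lemma dist_adj r x y : e x y ->
  (D r y).+1 = D r x \/ D r y = (D r x).+1.
Proof.
move=> xy; have := @dist_adj_neq r x y xy; have := dist_adj_le conn r xy.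
by have := dist_adj_le conn r (x := y) (y := x); rewrite e_sym => /(_ xy); lia.
Qed.

Lemma card_closer r x : #|[set y | e x y & D r y < D r x]| = (x != r).
Proof.
have [->|xr] /= := eqVneq x r.
  by apply/eqP; rewrite cards_eq0; apply/eqP/setP => y; rewrite !inE dist_refl andbF.
have x0 : 0 < D r x by rewrite lt0n; apply: contraNneq xr => /dist_eq0 ->.
have [y xy yx] := closer_neighbour conn e_sym x0.
apply/eqP/cards1P; exists y; apply/setP => z; rewrite !inE.
apply/andP/eqP => [[xz zx]|->]; last by split; rewrite // -yx.
by apply: (closer_unique (r := r) xz xy) => //; rewrite -yx.
Qed.

(** Root the tree at [r]. Each vertex but [r] has one closer neighbour, its parent; exchanging the
    sums, the farther neighbours also total [#|V| - 1]. *)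
Lemma handshake : \sum_x deg e x + 2 = 2 * #|V|.
Proof.
have /card_gt0P[r _] : 0 < #|V| by case: treeT.
have degE x : deg e x = (x != r) + #|[set y | e y x & D r x < D r y]|.
  rewrite -(card_closer r x) /deg -[LHS](cardsID [set y | D r y < D r x]).
  congr (_ + _); apply: eq_card => y; rewrite !inE //.
  rewrite -leqNgt (e_sym y x) andbC; case: (boolP (e x y)) => //= xy.
  by case: (dist_adj r xy) => h; lia.
have sumNr : \sum_x (x != r) = #|V|.-1.
  rewrite -(cardC1 r) -sum1_card [RHS]big_mkcond.
  by apply: eq_bigr => x _; rewrite !inE; case: eqP.
have V0 : 0 < #|V| by case: treeT.
rewrite (eq_bigr _ (fun x _ => degE x)) big_split /= sumNr.
suff -> : \sum_x #|[set y | e y x & D r x < D r y]| = #|V|.-1.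
  by rewrite -addnA mulnC; case: #|V| V0 => // m _; lia.
rewrite -sumNr; under [RHS]eq_bigr => x _ do rewrite -(card_closer r x).
under eq_bigr => x _ do rewrite -sum1dep_card big_mkcond /=.
by rewrite exchange_big; apply: eq_bigr => x _; rewrite -sum1dep_card [RHS]big_mkcond.
Qed.

Lemma deg_gt0 x : 1 < #|V| -> 0 < deg e x.
Proof.
move=> /card_gt1P[a [b [_ _ ab]]].
have [r rx] : exists r, r != x.
  by have [ax|ax] := eqVneq a x; [exists b; rewrite -ax eq_sym | exists a].
have x0 : 0 < D r x by rewrite lt0n; apply: contraNneq rx => /dist_eq0 ->.
have [y xy _] := closer_neighbour conn e_sym x0.
by apply/card_gt0P; exists y; rewrite inE.
Qed.

Lemma neighbour_avoiding x y : 1 < deg e x -> exists2 z, e x z & z != y.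
Proof.
move=> /card_gt1P[a [b []]]; rewrite !inE => xa xb ab.
by have [ay|ay] := eqVneq a y; [exists b; rewrite -?ay 1?eq_sym | exists a].
Qed.

(** * The path between two vertices *)

(** One step towards [y] from [u] and from [v] leads, by induction, to the same vertex, and both are
    its unique neighbour closer to [x]. *)
Lemma between_unique x y u v : D x u + D u y = D x y -> D x v + D v y = D x y ->
  D x u = D x v -> u = v.
Proof.
move E : (D u y) => m; elim: m u v E => [|m IH] u v E Eu Ev uv.
  have /dist_eq0 -> : D v y = 0 by lia.
  by rewrite (dist_eq0 E).
have up a : D x a + D a y = D x y -> 0 < D a y ->
    exists a', [/\ e a a', D x a' = (D x a).+1 & (D a' y).+1 = D a y].
  rewrite (dist_sym conn e_sym a y) => Ea a0.
  have [a' aa' a'y] := closer_neighbour conn e_sym a0.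
  exists a'; split; rewrite ?(dist_sym conn e_sym a' y) //.
  have := dist_triangle conn a' x y; have := dist_adj_le conn x aa'.
  by rewrite (dist_sym conn e_sym a' y); lia.
have [||u' [uu' xu' uy]] := up u; try lia.
have [||v' [vv' xv' vy]] := up v; try lia.
have uv' : u' = v' by apply: IH; lia.
by subst v'; apply: (closer_unique (r := x) (x := u')); rewrite ?(e_sym u') //; lia.
Qed.

Lemma between_exists x y i : i <= D x y ->
  exists2 v, D x v + D v y = D x y & D x v = i.
Proof.
move=> /subnKC; move: (D x y - i) => m; elim: m i => [|m IH] i Ei.
  by exists y; rewrite ?dist_refl; lia.
have [|v Ev vi] := IH i.+1; first lia.
have v0 : 0 < D x v by lia.
have [u vu uv] := closer_neighbour conn e_sym v0; exists u; last lia.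
have := dist_triangle conn u x y; have := dist_triangle conn v u y.
have : D u v <= 1 by apply: dist_edge; rewrite e_sym.
lia.
Qed.

(* The neighbour [a] starts the path from [v] to [x]; once that path moves away
   from [y] it keeps doing so, since each vertex has only one neighbour closer to
   [y]. *)
Lemma between_of_diverging x y v a : e v a -> (D x a).+1 = D x v ->
  D y a = (D y v).+1 -> D x v + D v y = D x y.
Proof.
move E : (D x a) => m; elim: m v a E => [|m IH] v a E va xv ya.
  have xa := dist_eq0 E; subst a.
  by rewrite (dist_sym conn e_sym v y) (dist_sym conn e_sym x y); lia.
have a0 : 0 < D x a by lia.
have [b ab ba] := closer_neighbour conn e_sym a0.
have yb : D y b = (D y a).+1.
  case: (dist_adj y ab) => // h.
  have bv : b = v by apply: (closer_unique (r := y) ab); rewrite 1?e_sym //; lia.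
  by subst b; lia.
have := IH a b; rewrite (dist_sym conn e_sym a y) (dist_sym conn e_sym v y).
by move=> /(_ _ ab _ yb); lia.
Qed.

(** Crossing an edge changes each of the two distances by exactly one, so the parity of their sum is
    constant along a walk from [y]. *)
Lemma dist_parity x y v : odd (D x v + D y v) = odd (D x y).
Proof.
have /connectP[p ep ->] := conn y v.
suff along a q : path e a q -> odd (D x a + D y a) = odd (D x y) ->
    odd (D x (last a q) + D y (last a q)) = odd (D x y).
  by apply: along ep _; rewrite dist_refl addn0.
elim: q a => [|b q IH] a //= /andP[ab bq] Ea.
apply: IH bq _; rewrite -Ea; case: (dist_adj x ab); case: (dist_adj y ab); lia.
Qed.

Lemma card_between x y : #|[set v | D x v + D v y == D x y]| = (D x y).+1.
Proof.
set B := [set v | _].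
have inB v : v \in B -> D x v + D v y = D x y by rewrite inE => /eqP.
have injB : {in B &, injective (fun v => inord (D x v) : 'I_(D x y).+1)}.
  move=> u v /inB Eu /inB Ev /(congr1 (@nat_of_ord _)); rewrite !inordK /=; try lia.
  exact: between_unique Eu Ev.
rewrite -(card_in_imset injB) -[RHS]card_ord -cardsT; apply: eq_card => i.
rewrite inE; apply/imsetP; have [v Ev vi] := @between_exists x y i (ltn_ord i).
by exists v; rewrite ?inE ?Ev // vi inord_val.
Qed.

(** * Leaves and the diameter *)

(** The only neighbour of an inner [v] would be closer to both [x] and [y], against the triangle
    inequality. *)
Lemma leaf_between x y v : D x v + D v y = D x y -> deg e v = 1 -> v = x \/ v = y.
Proof.
move=> Ev dv; have [x0|x0] := posnP (D x v); first by left; rewrite (dist_eq0 x0).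
have [y0|y0] := posnP (D v y); first by right; apply: dist_eq0 y0.
rewrite (dist_sym conn e_sym) in y0.
have [p vp px] := closer_neighbour conn e_sym x0.
have [q vq qy] := closer_neighbour conn e_sym y0.
have /cards1P[w Ew] : #|[set z | e v z]| == 1 by rewrite -/(deg e v) dv.
have pq : p = q.
  have : p \in [set z | e v z] by rewrite inE.
  have : q \in [set z | e v z] by rewrite inE.
  by rewrite Ew !inE => /eqP -> /eqP.
have := dist_triangle conn p x y.
by rewrite (dist_sym conn e_sym p y) -(dist_sym conn e_sym y v) in Ev *; subst q; lia.
Qed.

Lemma deg_farthest x y : x != y -> (forall z, D x z <= D x y) -> deg e y = 1.
Proof.
move=> xy far; have -> : 1 = (y != x) by rewrite eq_sym xy.
rewrite -(card_closer x y); apply: eq_card => z; rewrite !inE.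
case: (boolP (e y z)) => //= yz; have := far z.
by case: (dist_adj x yz); lia.
Qed.

(* [w] is a vertex farthest from [v] in the subtree hanging from [v] off the
   path from [x] to [y]. *)
Lemma leaf_below x y v : D x v + D v y <> D x y ->
  exists w, [/\ deg e w <= 1, D x w = D x v + D v w & D y w = D y v + D v w].
Proof.
move=> Nv; pose P w := (D x w == D x v + D v w) && (D y w == D y v + D v w).
have Pv : P v by rewrite /P dist_refl !addn0 !eqxx.
case: (arg_maxnP (D v) Pv) => w /andP[/eqP xw /eqP yw] wmax.
exists w; split => //; rewrite leqNgt; apply/negP => dw.
(* All neighbours of [w] other than [p] are then farther from [x], from [y] and from [v], so a
   second neighbour contradicts the choice of [w]. *)
have [p wp [px py]] : exists2 p, e w p & D x p < D x w /\ D y p < D y w.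
  have [v0|v0] := posnP (D v w).
    have vw := dist_eq0 v0; subst w; have x0 : 0 < D x v.
      by rewrite lt0n; apply/eqP => h; apply: Nv; rewrite h -(dist_eq0 h).
    have [p vp px] := closer_neighbour conn e_sym x0.
    exists p => //; split; first lia.
    case: (dist_adj y vp) => [|h]; first lia.
    by case: Nv; apply: between_of_diverging vp px h.
  have [p wp pv] := closer_neighbour conn e_sym v0; exists p => //.
  have := dist_triangle conn v x p; have := dist_triangle conn v y p; lia.
have [z wz zp] := neighbour_avoiding p dw.
have farther r : D r p < D r w -> D r z = (D r w).+1.
  move=> pr; case: (dist_adj r wz) => // h; case/eqP: zp.
  by apply: (closer_unique (r := r) wz wp) => //; lia.
have := farther x px; have := farther y py.
have := dist_triangle conn v x z; have := dist_adj_le conn v wz.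
move=> h1 h2 h3 h4.
have Pz : P z by rewrite /P; apply/andP; split; apply/eqP; lia.
by have := wmax z Pz; lia.
Qed.

Lemma card_leaves_le : 0 < diameter e ->
  #|degree_class e 1| + diameter e <= #|V|.+1.
Proof.
have V0 : 0 < #|V| by case: treeT.
have [x [y xy]] := diameter_attained e V0; rewrite -xy => d0.
set B := [set v | D x v + D v y == D x y].
have sub : degree_class e 1 \subset ~: B :|: [set x; y].
  apply/subsetP => v; rewrite !inE => /eqP dv.
  case: eqP => //= Ev; case: (leaf_between Ev dv) => ->; rewrite eqxx ?orbT //.
have := subset_leq_card sub; have := cardsC B; rewrite card_between.
by have := (leq_card_setU (~: B) [set x; y]).1; rewrite cards2; case: eqP; lia.
Qed.

Lemma card_leaves_ge : 0 < diameter e ->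
  #|V| <= (#|degree_class e 1| - 2) * (diameter e)./2 + (diameter e).+1.
Proof.
have V0 : 0 < #|V| by case: treeT.
have [x [y Exy]] := diameter_attained e V0; move=> d0.
have xy : x != y by apply: contraTneq d0 => xy; rewrite -Exy xy dist_refl.
have far r z : D r z <= D x y by rewrite Exy dist_le_diameter.
have dy : deg e y = 1 by apply: deg_farthest xy (far x).
have dx : deg e x = 1.
  apply: (@deg_farthest y x); first by rewrite eq_sym.
  by move=> z; rewrite (dist_sym conn e_sym y x).
set L := degree_class e 1; pose L' := L :\: [set x; y].
have cL : #|L'| + 2 = #|L|.
  rewrite /L' -[RHS](cardsID [set x; y]) addnC; congr (_ + _).
  rewrite (setIidPr _) ?cards2 ?xy //.
  by apply/subsetP => v; rewrite !inE => /orP[] /eqP ->; rewrite ?dx ?dy.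
set B := [set v | D x v + D v y == D x y].
(* [g v] is the leaf chosen below [v]; the vertices of [B] get an arbitrary value. *)
have /fin_all_exists[g gP] v : exists w, v \notin B ->
    [/\ w \in L', D x w = D x v + D v w & (D v w).+1 <= (diameter e)./2].
  have [vB|] := boolP (v \in B); first by exists v.
  rewrite inE => /eqP Nv; have [w [dw xw yw]] := leaf_below Nv.
  have V1 : 1 < #|V| by apply/card_gt1P; exists x, y.
  have dw1 : deg e w == 1 by have := deg_gt0 w V1; lia.
  have vx : v != x by apply: contra_notN Nv => /eqP ->; rewrite dist_refl.
  have vy : v != y by apply: contra_notN Nv => /eqP ->; rewrite dist_refl addn0.
  exists w => _; split=> //.
    rewrite !inE dw1 andbT negb_or; apply/andP; split.
      apply: contraNneq vx => wx; move: xw; rewrite wx dist_refl => xw.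
      by rewrite (@dist_eq0 _ e x v) //; lia.
    apply: contraNneq vy => wy; move: yw; rewrite wy dist_refl => yw.
    by rewrite (@dist_eq0 _ e y v) //; lia.
  have := far x w; have := far y w; have := dist_parity x y v.
  have := dist_triangle conn v x y; rewrite (dist_sym conn e_sym v y) in Nv *.
  by rewrite -Exy; lia.
suff : #|~: B| <= (#|L| - 2) * (diameter e)./2.
  by have := cardsC B; rewrite card_between Exy; lia.
have -> : #|L| - 2 = #|L'| by lia.
(* If the half is 0, then [gP] leaves no vertex off the path. Otherwise ['I_h.+1] is a nonempty
   range for the distances to the leaf. *)
case Eh : (diameter e)./2 => [|h].
  rewrite muln0 leqn0 cards_eq0; apply/eqP/setP => v; rewrite in_set0 in_setC.
  by apply: contraTF isT => /gP[_ _]; rewrite Eh.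
pose F v := (g v, inord (D v (g v)) : 'I_h.+1).
have injF : {in ~: B &, injective F}.
  (* Both [u] and [v] lie between [x] and their common leaf, at the same distance from it. *)
  move=> u v; rewrite !in_setC => /gP[_ Eu hu] /gP[_ Ev hv] [Eg].
  move/(congr1 (@nat_of_ord _)); rewrite !inordK /= -?Eh // => Euv.
  by apply: (@between_unique x (g u)); rewrite -?Eg in Ev Euv *; lia.
rewrite -(card_in_imset injF); have <- : #|setX L' [set: 'I_h.+1]| = #|L'| * h.+1.
  by rewrite cardsX cardsT card_ord.
apply/subset_leq_card/subsetP => _ /imsetP[v vB ->].
by rewrite in_setX in_setT andbT; move: vB; rewrite in_setC => /gP[].
Qed.

(** * Degree classes and the regular independence number *)

Local Notation big_deg := [set x | 2 < deg e x].

Lemma degree_counts : 1 < #|V| ->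
  [/\ #|V| = #|degree_class e 1| + #|degree_class e 2| + #|big_deg|,
      #|big_deg| + 2 <= #|degree_class e 1|
    & #|big_deg| = 0 -> #|degree_class e 1| = 2].
Proof.
move=> V1.
have cardE (A : pred V) : #|[set x | A x]| = \sum_x A x.
  by rewrite -sum1dep_card big_mkcond; apply: eq_bigr => x _; case: (A x).
have deg1 x := deg_gt0 x V1.
have degV x : deg e x <= #|V| by apply: max_card.
have sum2 : \sum_(x : V) 2 = 2 * #|V| by rewrite sum_nat_const mulnC.
rewrite -handshake in sum2; rewrite /degree_class !cardE; split.
- rewrite -!big_split -sum1_card; apply: eq_bigr => x _ /=.
  by have := deg1 x; case: (deg e x) => [|[|[|m]]].
(* The inequality holds term by term as degrees are positive; the degree sum then cancels up to
   2. *)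
- suff : \sum_(x : V) (2 + (2 < deg e x)) <= \sum_x (deg e x + (deg e x == 1)).
    by rewrite !big_split /= sum2; lia.
  by apply: leq_sum => x _; have := deg1 x; case: (deg e x) => [|[|[|m]]].
move=> z; have deg2 x : deg e x <= 2.
  have /eqP := z; rewrite sum_nat_eq0 => /forallP/(_ x) /=; lia.
suff : \sum_(x : V) 2 = \sum_x (deg e x + (deg e x == 1)).
  by rewrite big_split /= sum2; lia.
by apply: eq_bigr => x _; have := deg1 x; have := deg2 x; case: (deg e x) => [|[|[|m]]].
Qed.

Lemma alpha_reg_tree k : 2 <= k -> 2 < #|V| ->
  alpha_reg e k = maxn #|degree_class e 1| #|degree_class e 2|.
Proof.
move=> k2 V2; have [_ c3 _] := degree_counts (ltnW V2).
apply/eqP; rewrite eqn_leq geq_max; apply/and3P; split.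
- apply/bigmax_leqP => S /andP[_ /existsP[[i /= _] Si]].
  have := subset_leq_card Si; case: i {Si} => [|[|[|i]]].
  + have -> : degree_class e 0 = set0.
      by apply/setP => x; rewrite !inE; have := deg_gt0 x (ltnW V2); case: (deg e x).
    by rewrite cards0; lia.
  + by lia.
  + by lia.
  have : #|degree_class e i.+3| <= #|big_deg|.
    by apply/subset_leq_card/subsetP => x; rewrite !inE => /eqP ->.
  by lia.
- by apply: card_degree_class_le_alpha_reg; lia.
by apply: card_degree_class_le_alpha_reg.
Qed.

End Tree.

(** * Arithmetic of the four cases *)

Lemma leq_ceil_divn m d q : 0 < d -> (ceil_divn m d <= q) = (m <= q * d).
Proof.
move=> d0; rewrite /ceil_divn /dvdn {3}(divn_eq m d).
have := ltn_pmod m d0; move: (m %/ d) (m %% d) => a [|r] rd /=.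
  by rewrite !addn0 leq_pmul2r.
by rewrite addn1; apply/idP/idP => h; nia.
Qed.

Theorem theorem3p1 (k : nat) (V : finType) (e : rel V) (n t : nat)
    (k_ge2 : 2 <= k) (treeT : tree e) (orderT : #|V| = n) (n_ge8 : 8 <= n)
    (t_ge2 : 2 <= t) (t_le : t <= n - 3) (diamT : diameter e = n - t) :
  [/\ 3 * t <= n - 1 -> n - 2 * t <= alpha_reg e k <= n - 4,
      n <= 3 * t -> t <= n - 5 ->
        n + 2 <= 3 * alpha_reg e k /\
        alpha_reg e k <= maxn (n - f n t - 1) (t + 1),
      t = n - 4 -> ceil_divn (n - 1) 2 <= alpha_reg e k <= t + 1
    & t = n - 3 -> alpha_reg e k = t + 1].
Proof.
have d0 : 0 < diameter e by lia.
have := card_leaves_le treeT d0; have := card_leaves_ge treeT d0.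
have [|cV c3 c30] := degree_counts treeT; first by lia.
rewrite (alpha_reg_tree treeT k_ge2) ?orderT; last by lia.
rewrite orderT in cV; rewrite diamT.
move: #|degree_class e 1| #|degree_class e 2| #|[set x | 2 < deg e x]| cV c3 c30.
move=> n1 n2 n3 cV c3 c30 Lge Lle.
(* With two leaves or fewer, [Lge] would give [n <= n - t + 1], against [2 <= t]. *)
have n1_gt2 : 2 < n1.
  rewrite ltnNge; apply/negP => h; have E : n1 - 2 = 0 by lia.
  by move: Lge; rewrite E; lia.
have n3_gt0 : 0 < n3 by lia.
split.
- by lia.
- move=> nt tn; split; first lia.
  (* This bounds [n2 = n - n1 - n3]; [n1] is at most [t + 1] by [Lle]. *)
  suff : f n t + 1 <= n1 + n3 by lia.
  suff : f n t <= n1 by lia.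
  have hf : 2 * (t - 1) <= (n1 - 2) * (2 * (n - t)./2) by lia.
  (* Twice the half of [n - t] is the divisor in [f] for either parity. *)
  have -> : f n t = ceil_divn (2 * (t - 1)) (2 * (n - t)./2) + 2.
    by rewrite /f; case: ifP => o; congr (ceil_divn _ _ + _); lia.
  suff : ceil_divn (2 * (t - 1)) (2 * (n - t)./2) <= n1 - 2 by lia.
  by rewrite leq_ceil_divn //; lia.
- move=> tn; rewrite leq_ceil_divn //.
  have E : (n - t)./2 = 2 by lia.
  by rewrite E in Lge; lia.
move=> tn; have E : (n - t)./2 = 1 by lia.
by rewrite E in Lge; lia.
Qed.
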